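(* Let $\mathbf{V}$ be a nontrivial variety of groups. Then the category whose objects are ordered finite groups from $\mathbf{V}$ (finite groups from $\mathbf{V}$ equipped with a linear order of the underlying set) and whose morphisms are rigid epimorphisms has the dual Ramsey property. Moreover, the category $\mathbf{V}^{\mathit{fin}}_{\mathit{epi}}$, whose objects are the finite groups in $\mathbf{V}$ and whose morphisms are epimorphisms, has finite dual small Ramsey degrees.
   Context: A variety of groups is a class consisting of all groups that satisfy some set of identities in the language of groups; it is nontrivial if it contains a group with at least two elements. No compatibility between the linear order and the group operation is required. ''Epimorphism'' means surjective homomorphism. For finite linearly ordered sets $(A,<)$ and $(B,<)$, a surjective map $f:A\to B$ is a rigid surjection if $b_1<b_2$ implies $\min f^{-1}(b_1)<\min f^{-1}(b_2)$ for all $b_1,b_2\in B$. A rigid epimorphism between ordered finite groups is a map which is at the same time an epimorphism of groups and a rigid surjection of the underlying chains. Let $\mathbf{C}$ be a locally small category. For integers $k\ge2$, $t\ge1$ and objects $A,B,C$, write $C\longleftarrow(B)^A_{k,t}$ if for every coloring $\chi:\hom_{\mathbf{C}}(C,A)\to\{0,\dots,k-1\}$ there is a morphism $w\in\hom_{\mathbf{C}}(C,B)$ with $|\chi(\hom_{\mathbf{C}}(B,A)\cdot w)|\le t$, where $\hom_{\mathbf{C}}(B,A)\cdot w=\{f\cdot w:f\in\hom_{\mathbf{C}}(B,A)\}$. $\mathbf{C}$ has the dual Ramsey property if for every $k\ge 2$ and all objects $A,B$ there is an object $C$ with $C\longleftarrow(B)^A_{k,1}$. The dual small Ramsey degree $t^\partial_{\mathbf{C}}(A)$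 is the least positive integer $n$ such that for all $k\ge2$ and all objects $B$ there is an object $C$ with $C\longleftarrow(B)^A_{k,n}$, if such an integer exists, and $\infty$ otherwise. $\mathbf{C}$ has finite dual small Ramsey degrees if $t^\partial_{\mathbf{C}}(A)<\infty$ for every object $A$ of $\mathbf{C}$. *)

(* Defs.v *)
From mathcomp Require Import all_boot all_fingroup.
From mathcomp Require Import boolp.

Set Implicit Arguments.
Unset Strict Implicit.
Unset Printing Implicit Defensive.

(* [comp f w] is the composite written f . w: first w, then f. *)
Record category := Category {
  obj :> Type;
  hom : obj -> obj -> Type;
  idm : forall A, hom A A;
  comp : forall A B C, hom B C -> hom A B -> hom A C;
  comp_idl : forall A B (f : hom A B), comp (idm B) f = f;
  comp_idr : forall A B (f : hom A B), comp f (idm A) = f;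
  comp_assoc : forall A B C D (h : hom C D) (g : hom B C) (f : hom A B),
    comp h (comp g f) = comp (comp h g) f
}.

Section DualRamsey.
Variable K : category.

Definition dual_arrow (k t : nat) (C B A : K) : Prop :=
  forall chi : hom C A -> 'I_k, exists w : hom C B,
    #|[set c : 'I_k | `[< exists f : hom B A, chi (comp f w) = c >]]| <= t.

Definition dual_ramsey_property : Prop :=
  forall k (A B : K), 2 <= k -> exists C : K, dual_arrow k 1 C B A.

Definition dual_degree_bound (A : K) (n : nat) : Prop :=
  0 < n /\
  forall k (B : K), 2 <= k -> exists C : K, dual_arrow k n C B A.

Lemma dual_degree_bound_asbool (A : K) :
  (exists n, dual_degree_bound A n) -> exists n, `[< dual_degree_bound A n >].
Proof. by case=> n bn; exists n; apply/asboolP. Qed.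

(* The least bound, with [None] standing for infinity. *)
Definition dual_small_ramsey_degree (A : K) : option nat :=
  match pselect (exists n, dual_degree_bound A n) with
  | left exn => Some (ex_minn (dual_degree_bound_asbool exn))
  | right _ => None
  end.

Definition finite_dual_small_ramsey_degrees : Prop :=
  forall A : K, dual_small_ramsey_degree A <> None.

End DualRamsey.

Inductive group_term :=
  | tVar of nat
  | tOne
  | tInv of group_term
  | tMul of group_term & group_term.

Fixpoint eval_term (G : groupType) (v : nat -> G) (s : group_term) : G :=
  match s with
  | tVar i => v i
  | tOne => 1%g
  | tInv s1 => (eval_term v s1)^-1%g
  | tMul s1 s2 => (eval_term v s1 * eval_term v s2)%g
  end.

Definition satisfies (G : groupType) (s t : group_term) : Prop :=
  forall v : nat -> G, eval_term v s = eval_term v t.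

Definition is_variety (V : groupType -> Prop) : Prop :=
  exists E : group_term -> group_term -> Prop,
    forall G : groupType, V G <-> (forall s t, E s t -> satisfies G s t).

Definition nontrivial_variety (V : groupType -> Prop) : Prop :=
  is_variety V /\ exists G : groupType, V G /\ exists x y : G, x <> y.

Definition surjective (A B : Type) (f : A -> B) : Prop :=
  forall b, exists a, f a = b.

Definition epimorphism (G H : finGroupType) (f : G -> H) : Prop :=
  {morph f : x y / (x * y)%g} /\ surjective f.

Definition linear_order (T : Type) (le : rel T) : Prop :=
  [/\ antisymmetric le, transitive le & total le].

Definition strict (T : eqType) (le : rel T) : rel T :=
  fun x y => (x != y) && le x y.

Definition is_min (T : Type) (le : rel T) (P : T -> Prop) (m : T) : Prop :=
  P m /\ forall x, P x -> le m x.

(* In a finite chain every fibre of a surjection has exactly one minimum, so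
   a1 and a2 below are determined by b1 and b2. *)
Definition rigid_surjection (A B : finType) (leA : rel A) (leB : rel B)
    (f : A -> B) : Prop :=
  surjective f /\
  forall b1 b2 a1 a2,
    is_min leA (fun a => f a = b1) a1 ->
    is_min leA (fun a => f a = b2) a2 ->
    strict leB b1 b2 -> strict leA a1 a2.

Lemma surjective_comp (A B C : Type) (g : B -> C) (f : A -> B) :
  surjective g -> surjective f -> surjective (g \o f).
Proof. by move=> sg sf c; have [b <-] := sg c; have [a <-] := sf b; exists a. Qed.

Lemma epimorphism_id (G : finGroupType) : epimorphism (@id G).
Proof. by split=> // x; exists x. Qed.

Lemma epimorphism_comp (G H L : finGroupType) (g : H -> L) (f : G -> H) :
  epimorphism g -> epimorphism f -> epimorphism (g \o f).
Proof.
move=> [mg sg] [mf sf]; split; last exact: surjective_comp.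
by move=> x y; rewrite /= mf mg.
Qed.

Lemma is_min_exists (T : finType) (le : rel T) (P : T -> Prop) (x0 : T) :
  linear_order le -> P x0 -> exists m, is_min le P m.
Proof.
case=> anti tr tot Px0.
have lexx x : le x x by have := tot x x; rewrite orbb.
have Px0' : `[< P x0 >] by apply/asboolP.
case: (@arg_minnP T x0 (fun x => `[< P x >]) (fun x => #|[set y | le y x]|) Px0').
move=> m /asboolP Pm minm; exists m; split=> // x Px.
case/orP: (tot m x) => // lexm.
have sub : [set y | le y x] \subset [set y | le y m].
  by apply/subsetP=> y; rewrite !inE => leyx; apply: tr lexm.
have /eqP/setP/(_ m) : [set y | le y x] == [set y | le y m].
  by rewrite eqEcard sub minm //; apply/asboolP.
by rewrite !inE lexx.
Qed.

Lemma rigid_surjection_id (A : finType) (leA : rel A) :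
  rigid_surjection leA leA (@id A).
Proof.
split; first by move=> x; exists x.
by move=> b1 b2 a1 a2 [-> _] [-> _].
Qed.

Lemma is_min_fibre_comp (A B C : finType) (leA : rel A) (leB : rel B)
    (g : B -> C) (f : A -> B) (c : C) (a : A) :
  linear_order leA -> linear_order leB -> rigid_surjection leA leB f ->
  is_min leA (fun x => g (f x) = c) a ->
  is_min leB (fun y => g y = c) (f a) /\ is_min leA (fun x => f x = f a) a.
Proof.
move=> oA oB [sf rf] [ga mina].
have fmin : is_min leA (fun x => f x = f a) a.
  by split=> // x fx; apply: mina; rewrite fx.
split=> //; split=> // y gy; have [antiB _ totB] := oB; have [antiA _ _] := oA.
case/orP: (totB (f a) y) => // leya.
have [-> |neq] := eqVneq y (f a); first by have := totB (f a) (f a); rewrite orbb.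
have [x0 fx0] := sf y.
have [x minx] := @is_min_exists A leA (fun x => f x = y) x0 oA fx0.
have /andP[nxa lexa] : strict leA x a.
  by apply: rf minx fmin _; rewrite /strict neq.
have leax : leA a x by apply: mina; rewrite minx.1.
by case/eqP: nxa; apply: antiA; rewrite lexa leax.
Qed.

Lemma rigid_surjection_comp (A B C : finType)
    (leA : rel A) (leB : rel B) (leC : rel C) (g : B -> C) (f : A -> B) :
  linear_order leA -> linear_order leB ->
  rigid_surjection leB leC g -> rigid_surjection leA leB f ->
  rigid_surjection leA leC (g \o f).
Proof.
move=> oA oB [sg rg] rsf; split; first exact: surjective_comp rsf.1.
move=> c1 c2 a1 a2.
move=> /(is_min_fibre_comp oA oB rsf)[m1 n1].
move=> /(is_min_fibre_comp oA oB rsf)[m2 n2] lt12.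
by apply: rsf.2 n1 n2 _; apply: rg m1 m2 lt12.
Qed.

Section Categories.
Variable V : groupType -> Prop.

Record fin_group := FinGroupIn {
  fg_group :> finGroupType;
  fg_variety : V fg_group
}.

Record ord_fin_group := OrdFinGroupIn {
  og_group :> finGroupType;
  og_variety : V og_group;
  og_le : rel og_group;
  og_linear : linear_order og_le
}.

Definition epi_hom (G H : fin_group) := {f : G -> H | epimorphism f}.

Definition epi_id (G : fin_group) : epi_hom G G :=
  exist _ id (epimorphism_id G).

Definition epi_comp (G H L : fin_group) (g : epi_hom H L) (f : epi_hom G H) :
    epi_hom G L :=
  exist _ (sval g \o sval f) (epimorphism_comp (svalP g) (svalP f)).

Definition fin_epi_category : category.
Proof.
apply: (@Category fin_group epi_hom epi_id epi_comp).
- by move=> G H [f pf]; apply: eq_exist.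
- by move=> G H [f pf]; apply: eq_exist.
- by move=> G H L M h g f; apply: eq_exist.
Defined.

Definition rigid_epimorphism (G H : ord_fin_group) (f : G -> H) : Prop :=
  epimorphism f /\ rigid_surjection (@og_le G) (@og_le H) f.

Definition rigid_epi_hom (G H : ord_fin_group) :=
  {f : G -> H | rigid_epimorphism f}.

Lemma rigid_epimorphism_id (G : ord_fin_group) :
  @rigid_epimorphism G G id.
Proof. split; [exact: epimorphism_id | exact: rigid_surjection_id]. Qed.

Lemma rigid_epimorphism_comp (G H L : ord_fin_group) (g : H -> L) (f : G -> H) :
  rigid_epimorphism g -> rigid_epimorphism f -> rigid_epimorphism (g \o f).
Proof.
move=> [eg rg] [ef rf]; split; first exact: epimorphism_comp.
exact: rigid_surjection_comp (og_linear G) (og_linear H) rg rf.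
Qed.

Definition rigid_epi_id (G : ord_fin_group) : rigid_epi_hom G G :=
  exist _ id (rigid_epimorphism_id G).

Definition rigid_epi_comp (G H L : ord_fin_group)
    (g : rigid_epi_hom H L) (f : rigid_epi_hom G H) : rigid_epi_hom G L :=
  exist _ (sval g \o sval f) (rigid_epimorphism_comp (svalP g) (svalP f)).

Definition ord_fin_rigid_epi_category : category.
Proof.
apply: (@Category ord_fin_group rigid_epi_hom rigid_epi_id rigid_epi_comp).
- by move=> G H [f pf]; apply: eq_exist.
- by move=> G H [f pf]; apply: eq_exist.
- by move=> G H L M h g f; apply: eq_exist.
Defined.

End Categories.

(* Main.v *)
Require Import Defs.
From mathcomp Require Import all_boot all_fingroup.
From mathcomp Require Import boolp zify.

Set Implicit Arguments.
Unset Strict Implicit.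
Unset Printing Implicit Defensive.

(** Order the elements of a finite group in a chain.  The theorem then follows
    from the finite dual Ramsey theorem for chains and rigid surjections,
    because relatively free groups carry it over to ordered groups.

    Let [F] be the free group on a chain of [n] generators in the variety
    generated by [B]; it is a subgroup of a finite power of [B], hence finite
    and in [V].  Order [F] so that the generators come first.  A rigid
    surjection from the chain of generators onto [B] extends to an epimorphism
    from [F], which is rigid since the least element of each fibre is a
    generator ([free_ext_rigid]).  A morphism from [F] is determined by its
    values at the generators, so a colouring of morphisms from [F] to [A] is a
    colouring of rigid surjections of chains, and extension commutes with
    composition ([ordered_groups_dual_ramsey]).

    The theorem for chains ([dual_ramsey_for_words]) is Graham and Rothschild's
    theorem on partitions of a finite set.  A rigid surjection is written as
    the word of its values, and the proof is by induction on the number [k] of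
    letters.  Cut a word with [k.+1] letters where its last new letter appears
    for the first time.  What comes after the cut is made irrelevant to the
    colour by the Hales-Jewett theorem, and what comes before the cut is a word
    with [k] letters, to which the induction hypothesis applies; then the
    colour depends on the position of the cut only
    ([color_depends_on_last_new_letter]), and the pigeonhole principle
    finishes.

    Without orders, fix an order on [B].  Every epimorphism from [B] to [A] is
    rigid for exactly one order on [A], so at most one colour per order on [A]
    is needed ([groups_finite_dual_degrees]). *)

(** * The Hales-Jewett theorem *)

Definition letters_below (t : nat) (w : seq nat) : bool := all (fun c => c < t) w.

Definition plug (c : nat) (y : seq (option nat)) : seq nat := map (odflt c) y.

Definition variable_word (t n : nat) (y : seq (option nat)) : bool :=
  [&& size y == n, None \in y & all (oapp (fun c => c < t) true) y].

Definition monochromatic_line (K : Type) (t : nat) (chi : seq nat -> K)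
    (y : seq (option nat)) : Prop :=
  forall c, c < t -> chi (plug c y) = chi (plug 0 y).

Lemma size_plug c y : size (plug c y) = size y.
Proof. exact: size_map. Qed.

Lemma plug_cat c y z : plug c (y ++ z) = plug c y ++ plug c z.
Proof. exact: map_cat. Qed.

Lemma plug_Some c w : plug c (map Some w) = w.
Proof. by rewrite /plug -map_comp map_id. Qed.

Lemma letters_below_plug t n c y :
  c < t -> variable_word t n y -> letters_below t (plug c y).
Proof.
move=> ct /and3P[_ _]; rewrite /letters_below all_map; apply: sub_all.
by case=> //= _.
Qed.

Lemma variable_word_widen t s n y :
  t <= s -> variable_word t n y -> variable_word s n y.
Proof.
move=> ts /and3P[sy ny ay]; apply/and3P; split=> //.
by apply: sub_all ay => -[a|] //= /leq_trans; apply.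
Qed.

Lemma variable_word_cat t n m y z :
  variable_word t n y -> variable_word t m z -> variable_word t (n + m) (y ++ z).
Proof.
move=> /and3P[/eqP sy ny ay] /and3P[/eqP sz _ az].
by rewrite /variable_word size_cat sy sz eqxx mem_cat ny all_cat ay az.
Qed.

Lemma variable_word_catS t n m y w :
  variable_word t n y -> size w = m -> letters_below t w ->
  variable_word t (n + m) (y ++ map Some w).
Proof.
move=> /and3P[/eqP sy ny ay] sw aw.
by rewrite /variable_word size_cat size_map sy sw eqxx mem_cat ny all_cat ay all_map.
Qed.

Lemma variable_word_Scat t n m y w :
  variable_word t n y -> size w = m -> letters_below t w ->
  variable_word t (m + n) (map Some w ++ y).
Proof.
move=> /and3P[/eqP sy ny ay] sw aw.
rewrite /variable_word size_cat size_map sy sw eqxx mem_cat ny orbT.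
by rewrite all_cat ay andbT all_map.
Qed.

(** A colouring of pairs of words is a colouring of first components by
    functions; when the second components are bounded in length and alphabet,
    the functions form a finite set of colours again. *)
Definition section_coloring (K : finType) (t n : nat) 
    (chi : seq nat -> seq nat -> K) (x : seq nat) : {ffun n.-tuple 'I_t -> K} :=
  [ffun z : n.-tuple 'I_t => chi x [seq val i | i <- z]].

Lemma section_coloringP (K : finType) t n (chi : seq nat -> seq nat -> K) x x' z :
  section_coloring t n chi x = section_coloring t n chi x' ->
  size z = n -> letters_below t z -> chi x z = chi x' z.
Proof.
move=> eqs sz az.
have [z' zz'] : exists z' : n.-tuple 'I_t, [seq val i | i <- z'] = z.
  have ez : [seq val i | i <- pmap (insub : nat -> option 'I_t) z] = z.
    rewrite pmap_filter ?(all_filterP _) //; last exact: insubK.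
    by apply: sub_all az => c ct; rewrite /= insubT.
  have sz' : size (pmap (insub : nat -> option 'I_t) z) == n.
    by rewrite -sz -{2}ez size_map.
  by exists (Tuple sz').
by move/ffunP/(_ z'): eqs; rewrite !ffunE zz'.
Qed.

Definition hales_jewett_for (t : nat) : Prop :=
  forall K : finType, exists n, forall chi : seq nat -> K,
    exists2 y, variable_word t n y & monochromatic_line t chi y.

(** Colour focusing: lines over [t.+1] letters which meet in their last point
    [p] and are, up to that point, monochromatic in pairwise distinct colours.
    A longer family is obtained by prefixing all its members with one
    line which is monochromatic for the section colouring. *)
Lemma focused_lines (t : nat) (K : finType) (s : nat) :
  0 < t -> hales_jewett_for t ->
  exists n, forall chi : seq nat -> K,
    (exists2 y, variable_word t.+1 n y & monochromatic_line t.+1 chi y) \/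
    exists p ys, [/\ size p = n, letters_below t.+1 p, size ys = s,
      uniq [seq chi (plug 0 y) | y <- ys] &
      forall y, y \in ys ->
        [/\ variable_word t.+1 n y, plug t y = p & monochromatic_line t chi y]].
Proof.
move=> t0 HJ; elim: s => [|s [n IH]].
  by exists 0 => chi; right; exists [::], [::].
have [N HN] := HJ {ffun n.-tuple 'I_t.+1 -> K}.
exists (N + n) => chi.
have [Y vY monoY] := HN (section_coloring t.+1 n (fun x z => chi (x ++ z))).
have vY1 : variable_word t.+1 N Y by apply: variable_word_widen vY.
have sY : size Y = N by case/and3P: vY => /eqP.
have l0Y : letters_below t.+1 (plug 0 Y) by apply: letters_below_plug vY1.
have secY c z : c < t -> size z = n -> letters_below t.+1 z ->
    chi (plug c Y ++ z) = chi (plug 0 Y ++ z).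
  by move=> ct sz lz; apply: (section_coloringP (monoY c ct) sz lz).
pose chi' z := chi (plug 0 Y ++ z).
have lift y : variable_word t.+1 n y -> monochromatic_line t.+1 chi' y ->
    exists2 y, variable_word t.+1 (N + n) y & monochromatic_line t.+1 chi y.
  move=> vy my; exists (map Some (plug 0 Y) ++ y).
    by apply: variable_word_Scat; rewrite ?size_plug.
  by move=> c ct; rewrite !plug_cat !plug_Some; apply: my.
case: (IH chi') => [[y vy my]|[p [ys [sp lp sys uys Pys]]]].
  by left; apply: lift vy my.
have [/mapP[y yin eqy]|nin] := boolP (chi' p \in [seq chi' (plug 0 y) | y <- ys]).
  have [vy py my] := Pys y yin; left; apply: lift vy _ => c.
  rewrite ltnS leq_eqVlt => /predU1P[->|]; first by rewrite py.
  exact: my.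
right; exists (plug t Y ++ p), ((Y ++ map Some p) :: [seq Y ++ y | y <- ys]).
split.
- by rewrite size_cat size_plug sY sp.
- by rewrite /letters_below all_cat -!/(letters_below _ _) lp
             (letters_below_plug _ vY1).
- by rewrite /= size_map sys.
- rewrite /= -map_comp plug_cat plug_Some; apply/andP; split.
    rewrite (_ : map _ ys = [seq chi' (plug 0 y) | y <- ys]) //.
    by apply: eq_map => y; rewrite /= plug_cat.
  rewrite (_ : map _ ys = [seq chi' (plug 0 y) | y <- ys]) //.
  by apply: eq_map => y; rewrite /= plug_cat.
- move=> y; rewrite inE => /predU1P[->|/mapP[z zin ->]].
    split; [exact: variable_word_catS | by rewrite plug_cat plug_Some |].
    by move=> c ct; rewrite !plug_cat !plug_Some; apply: secY.
  have [vz pz mz] := Pys z zin.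
  split; [exact: variable_word_cat | by rewrite plug_cat pz |].
  move=> c ct; rewrite !plug_cat secY //; first exact: mz.
    by rewrite size_plug; case/and3P: vz => /eqP.
  by apply: letters_below_plug vz; apply: ltnW.
Qed.

Lemma hales_jewett t : hales_jewett_for t.
Proof.
elim: t => [|t IH] K; first by exists 1 => chi; exists [:: None].
have [->|t0] := posnP t.
  by exists 1 => chi; exists [:: None] => //; case.
(* With as many focused lines as there are colours, the colour of the common
   end point is that of one of the lines. *)
have [n Hn] := @focused_lines t K #|K| t0 IH.
exists n => chi; case: (Hn chi) => // -[p [ys [_ _ sys uys Pys]]].
have : chi p \in [seq chi (plug 0 y) | y <- ys].
  have [|_ ->] := uniq_min_size uys (fun x _ => mem_enum K x); last first.
    by rewrite mem_enum.
  by rewrite -cardE size_map sys.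
case/mapP=> y yin eqy; have [vy py my] := Pys y yin.
exists y => // c; rewrite ltnS leq_eqVlt => /predU1P[->|]; first by rewrite py.
exact: my.
Qed.

(** * Rigid words *)

(** A rigid word with [m] letters and length [n] is a rigid surjection from the
    chain of [n] elements onto the chain of [m] elements, listed value by
    value. *)
Definition rigid_word (m : nat) (w : seq nat) : Prop :=
  [/\ letters_below m w, forall x, x < m -> x \in w &
      forall x y, x < y -> y < m -> index x w < index y w].

Definition word_comp (f g : seq nat) : seq nat := map (nth 0 g) f.

Lemma rigid_word_mem m w x : rigid_word m w -> (x \in w) = (x < m).
Proof.
by case=> aw sw _; apply/idP/idP=> [xw|]; [apply: (allP aw) | apply: sw].
Qed.

Lemma rigid_word_nth m w i : rigid_word m w -> i < size w -> nth 0 w i < m.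
Proof. by move=> rw iw; rewrite -(rigid_word_mem _ rw) mem_nth. Qed.

Lemma index_unique (T : eqType) (x0 : T) (w : seq T) x i :
  i < size w -> nth x0 w i = x -> (forall j, j < i -> nth x0 w j <> x) ->
  index x w = i.
Proof.
move=> iw wi wj; have xw : x \in w by rewrite -wi mem_nth.
case: (ltngtP (index x w) i) => // [lt|lt].
  by case: (wj _ lt); rewrite nth_index.
by have := before_find x0 lt; rewrite /= wi eqxx.
Qed.

(** The first occurrence of [x] in the composite comes from the first
    position carrying the least letter sent to [x]. *)
Lemma index_word_comp m h g x :
  rigid_word m h -> size g = m -> x \in g ->
  index x (word_comp h g) = index (index x g) h.
Proof.
move=> rh sg xg; have tm : index x g < m by rewrite -sg index_mem.
have th : index x g \in h by rewrite (rigid_word_mem _ rh).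
have ih : index (index x g) h < size h by rewrite index_mem.
apply: (@index_unique _ 0); first by rewrite size_map.
  by rewrite (nth_map 0) // !nth_index.
move=> j ji; have jh : j < size h by apply: ltn_trans ji ih.
rewrite (nth_map 0) //; set y := nth 0 h j => gy.
have yx : index x g <= y.
  rewrite leqNgt; apply/negP=> lt; have := before_find 0 lt.
  by rewrite /= gy eqxx.
have yj : index y h <= j.
  by rewrite leqNgt; apply/negP=> lt; have := before_find 0 lt; rewrite /= eqxx.
have : index (index x g) h <= index y h.
  move: yx; rewrite leq_eqVlt => /predU1P[->//|lt].
  by apply: ltnW; case: rh => aw _; apply=> //; apply: (allP aw); apply: mem_nth.
by move=> le; have := leq_trans le yj; rewrite leqNgt ji.
Qed.

Lemma size_word_comp f g : size (word_comp f g) = size f.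
Proof. exact: size_map. Qed.

Lemma rigid_word_comp m k f g :
  rigid_word m f -> size g = m -> rigid_word k g -> rigid_word k (word_comp f g).
Proof.
move=> rf sg rg; split.
- apply/allP=> _ /mapP[a af ->]; apply: rigid_word_nth rg _.
  by rewrite sg -(rigid_word_mem _ rf).
- move=> x xk; have xg : x \in g by rewrite (rigid_word_mem _ rg).
  apply/mapP; exists (index x g); last by rewrite nth_index.
  by rewrite (rigid_word_mem _ rf) -sg index_mem.
- move=> x y xy yk; have xk := ltn_trans xy yk.
  rewrite !(index_word_comp rf) ?(rigid_word_mem _ rg) //.
  have [_ _ incf] := rf; have [_ _ incg] := rg.
  by apply: incf; [exact: incg | rewrite -sg index_mem (rigid_word_mem _ rg)].
Qed.

Lemma word_compA m k f g h :
  letters_below m f -> size g = m -> letters_below k g -> size h = k ->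
  word_comp (word_comp f g) h = word_comp f (word_comp g h).
Proof.
move=> lf sg lg sh; rewrite /word_comp -map_comp; apply/eq_in_map=> a af /=.
by rewrite (nth_map 0) // sg; apply: (allP lf).
Qed.

Lemma rigid_word0 w : rigid_word 0 w -> w = [::].
Proof. by case: w => // a w [/andP[]]. Qed.

Lemma rigid_word_cat m w s :
  rigid_word m w -> letters_below m s -> rigid_word m (w ++ s).
Proof.
move=> rw ls; have [lw mw iw] := rw; split.
- by rewrite /letters_below all_cat -!/(letters_below _ _) lw.
- by move=> x xm; rewrite mem_cat mw.
- move=> x y xy ym; rewrite !index_cat !mw ?(ltn_trans xy) //; exact: iw.
Qed.

Lemma rigid_word_catS m w s :
  rigid_word m w -> letters_below m.+1 s -> m \in s -> rigid_word m.+1 (w ++ s).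
Proof.
move=> rw ls ms; have [lw mw iw] := rw; split.
- rewrite /letters_below all_cat -!/(letters_below _ _) ls andbT.
  by apply: sub_all lw => a /ltnW.
- move=> x; rewrite ltnS leq_eqVlt mem_cat => /predU1P[->|/mw->//].
  by rewrite ms orbT.
- move=> x y xy; rewrite ltnS leq_eqVlt !index_cat !(rigid_word_mem _ rw).
  case/predU1P=> [ym|ym]; last by rewrite ym (ltn_trans xy ym); apply: iw.
  rewrite -ym xy ltnn ltn_addr // index_mem.
  by rewrite mw // -ym.
Qed.

Lemma rigid_word_rcons m k g :
  rigid_word k.+1 g -> size g = m.+1 ->
  exists w c, [/\ g = rcons w c, size w = m &
    (c = k /\ rigid_word k w) \/ (c < k.+1 /\ rigid_word k.+1 w)].
Proof.
case/lastP: g => [//|w c] rg; rewrite size_rcons => -[sw].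
exists w, c; split=> //; have [lg mg ig] := rg.
move: lg; rewrite /letters_below all_rcons -/(letters_below _ _) => /andP[ck lw].
have memw x : x < k.+1 -> x != c -> x \in w.
  by move=> xk xc; have := mg x xk; rewrite mem_rcons inE (negPf xc).
have idx x : x \in w -> index x (rcons w c) = index x w.
  by move=> xw; rewrite -cats1 index_cat xw.
have [kw|kw] := boolP (k \in w).
  have allw x : x < k.+1 -> x \in w.
    rewrite ltnS leq_eqVlt => /predU1P[->//|xk].
    have := ig x k xk (ltnSn k); rewrite (idx _ kw) -cats1 index_cat.
    by case: ifP => // _; have := index_size k w; lia.
  right; split=> //; split=> // x y xy yk.
  by rewrite -!idx ?allw ?(ltn_trans xy) //; apply: ig.
have ckE : c = k.
  by apply/eqP; rewrite eq_sym; apply: contraR kw => kc; apply: memw.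
left; split=> //; have allw x : x < k -> x \in w.
  by move=> xk; apply: memw; rewrite ?ckE ?neq_ltn ?xk // ltnW.
split=> //.
  apply/allP=> a aw; have := allP lw a aw; rewrite ltnS leq_eqVlt.
  by case/predU1P=> // ak; rewrite -ak aw in kw.
move=> x y xy yk; rewrite -!idx ?allw ?(ltn_trans xy) //.
by apply: ig => //; apply: ltnW.
Qed.

Lemma rigid_word_iota m : rigid_word m (iota 0 m).
Proof.
have idx x : x < m -> index x (iota 0 m) = x.
  move=> xm; apply: (@index_unique _ 0); rewrite ?size_iota ?nth_iota //.
  by move=> j jx; rewrite nth_iota ?(ltn_trans jx) // => jE; rewrite -jE ltnn in jx.
split; first by apply/allP=> x; rewrite mem_iota.
  by move=> x; rewrite mem_iota.
by move=> x y xy ym; rewrite !idx // (ltn_trans xy).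
Qed.

(** * The dual Ramsey theorem for rigid words *)

Definition dual_ramsey_words (k : nat) : Prop :=
  forall (m : nat) (K : finType), exists n, forall chi : seq nat -> K,
    exists f c, [/\ size f = n, rigid_word m f &
      forall g, size g = m -> rigid_word k g -> chi (word_comp f g) = c].

(** A word [w] followed by a block whose constants are read as positions in
    [w], to be replaced by the letters found there, and whose variable becomes
    [c].  With the constants read like this, one block [y] serves all [w]. *)
Definition extend (w : seq nat) (c : nat) (y : seq (option nat)) : seq nat :=
  w ++ map (oapp (nth 0 w) c) y.

Lemma word_comp_extend f w c y :
  letters_below (size w) f ->
  all (oapp (fun a => a < size f) true) y ->
  word_comp (extend f (size w) y) (rcons w c) = extend (word_comp f w) c y.
Proof.
move=> lf ly; rewrite /extend /word_comp map_cat; congr (_ ++ _).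
  apply/eq_in_map=> a af; have := allP lf a af; rewrite nth_rcons => /= ->.
  by [].
rewrite -map_comp; apply/eq_in_map=> -[a|] yin /=; last first.
  by rewrite nth_rcons ltnn eqxx.
have af := allP ly _ yin; rewrite /= in af.
rewrite (nth_map 0) // nth_rcons.
by have := allP lf (nth 0 f a); rewrite mem_nth // => /(_ isT) ->.
Qed.

Lemma extend_rigid m L w y :
  rigid_word m w -> variable_word (size w) L y ->
  rigid_word m.+1 (extend w m y).
Proof.
move=> rw /and3P[_ ny ay]; apply: rigid_word_catS => //.
  rewrite /letters_below all_map; apply: sub_all ay => -[a|] //= aw.
  by apply: ltnW; apply: rigid_word_nth rw aw.
by apply/mapP; exists None.
Qed.

(** The Hales-Jewett theorem over an alphabet of [M] letters: a rigid word of
    length [M] turns each of these letters into one of its own, and each of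
    its own letters arises in this way. *)
Lemma insensitive_extension (M k : nat) (K : finType) :
  exists L, forall chi : seq nat -> K, exists2 y, variable_word M L y &
    forall w c, size w = M -> rigid_word k.+1 w -> c < k.+1 ->
      chi (extend w c y) = chi (extend w 0 y).
Proof.
have [L HL] := @hales_jewett M {ffun M.-tuple 'I_k.+1 -> K}.
exists L => chi.
have [y vy my] := HL (section_coloring k.+1 M
  (fun x w => chi (w ++ word_comp x w))).
exists y => // w c sw rw ck.
have ext a : a < k.+1 ->
    chi (extend w a y) = chi (w ++ word_comp (plug 0 y) w).
  move=> ak; have aw : index a w < M by rewrite -sw index_mem (rigid_word_mem _ rw).
  have [lw _ _] := rw; rewrite -(section_coloringP (my _ aw) sw lw).
  congr (chi (_ ++ _)); rewrite /word_comp -map_comp; apply: eq_map => -[b|] //=.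
  by rewrite nth_index // (rigid_word_mem _ rw).
by rewrite !ext.
Qed.

(** Writing a rigid word with [k.+1] letters as [u k s], with [k] not in [u],
    the theorem for [k] letters yields a word after which the colour depends
    on the length of [u] only.  The word is built from its end: in the last
    block, either the last letter is the new one, and the theorem for [k]
    letters makes the colour constant, or the new letter has occurred before,
    and by the insensitive extension the last letter does not matter. *)
Lemma color_depends_on_last_new_letter (k m : nat) (K : finType) :
  dual_ramsey_words k ->
  exists n, forall chi : seq nat -> K,
    exists f (c : nat -> K), [/\ size f = n, rigid_word m f &
      forall g, size g = m -> rigid_word k.+1 g ->
        chi (word_comp f g) = c (index k g)].
Proof.
move=> Dk; elim: m => [|m [N HN]].
  exists 0 => chi; exists [::], (fun _ => chi [::]).
  by split=> //; apply: (rigid_word_iota 0).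
have [M HM] := Dk N K; have [L HL] := insensitive_extension M k K.
exists (M + L) => chi; have [y vy insy] := HL chi.
have [f0 [ca [sf0 rf0 Pf0]]] := HM (fun u => chi (extend u k y)).
have [f1 [cb [sf1 rf1 Pf1]]] := HN (fun w => chi (extend (word_comp f0 w) 0 y)).
pose f := word_comp f0 f1.
have sf : size f = M by rewrite size_word_comp.
have rf : rigid_word m f by apply: rigid_word_comp rf0 sf1 rf1.
have [lf0 _ _] := rf0; have [lf1 _ _] := rf1; have [lf _ _] := rf.
exists (extend f m y), (fun j => if j == m then ca else cb j); split.
- by rewrite size_cat sf size_map; case/and3P: vy => /eqP->.
- by apply: extend_rigid rf _; rewrite sf; apply: vy.
move=> g sg rg; have [w [c [-> sw cw]]] := rigid_word_rcons rg sg.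
rewrite -sw word_comp_extend ?sw ?sf //; last by case/and3P: vy.
rewrite (word_compA lf0 sf1 lf1 sw) -cats1 index_cat.
case: cw => [[-> rw]|[ck rw]].
  rewrite (rigid_word_mem _ rw) ltnn /= eqxx addn0 sw eqxx; apply: Pf0.
    by rewrite size_word_comp.
  exact: rigid_word_comp rf1 sw rw.
have kw : k \in w by rewrite (rigid_word_mem _ rw).
have km : index k w < m by rewrite -sw index_mem.
rewrite kw (ltn_eqF km) -Pf1 // insy ?size_word_comp //.
apply: rigid_word_comp rf0 _ _; rewrite ?size_word_comp //.
exact: rigid_word_comp rf1 sw rw.
Qed.

Lemma popular_color (K : finType) (T : Type) (c : T -> K) (s : seq T) (m : nat) :
  #|K| * m < size s -> exists i, m <= count (fun j => c j == i) s.
Proof.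
move=> lt; apply/existsP; apply: contraTT lt => /existsPn no.
have -> : size s = \sum_(i : K) count (fun j => c j == i) s.
  elim: s {no} => [|x s IH] /=; first by rewrite big1.
  rewrite big_split /= -IH (bigD1 (c x)) //= eqxx big1 // => i.
  by rewrite eq_sym => /negPf->.
rewrite -leqNgt -sum_nat_const; apply: leq_sum => i _.
by rewrite ltnW // ltnNge no.
Qed.

(** The positions outside [P] are filled with the letter [0], which has to
    occur first: hence the exception for [t = 0]. *)
Lemma rigid_word_new_letters (P : pred nat) (n m : nat) :
  m <= count P (iota 1 n) ->
  exists h, [/\ size h = n.+1, rigid_word m.+1 h &
    forall t, 0 < t -> t < m.+1 -> P (index t h)].
Proof.
elim: n m => [|n IH] m.
  rewrite leqn0 => /eqP->; exists [:: 0]; split=> //.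
    split=> // [[]|x []] //.
  by case.
have -> : iota 1 n.+1 = iota 1 n ++ [:: n.+1] by rewrite -[n.+1]addn1 iotaD addn1.
rewrite count_cat /= addn0.
have [le _|lt le] := leqP m (count P (iota 1 n)).
  have [h [sh rh Ph]] := IH m le; exists (h ++ [:: 0]); split.
  - by rewrite size_cat sh addn1.
  - exact: rigid_word_cat.
  - move=> t t0 tm; rewrite index_cat (rigid_word_mem _ rh) tm; exact: Ph.
have Pn : P n.+1 by move: le lt; case: (P n.+1) => //; lia.
have [//|h [sh rh Ph]] := IH m.-1; first by lia.
have m0 : 0 < m by lia.
rewrite prednK // in rh Ph.
exists (h ++ [:: m]); split.
- by rewrite size_cat sh addn1.
- by apply: rigid_word_catS; rewrite ?inE /letters_below //= ltnSn.
- move=> t t0; rewrite ltnS leq_eqVlt index_cat (rigid_word_mem _ rh).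
  case/predU1P=> [->|tm]; last by rewrite tm; apply: Ph.
  by rewrite ltnn /= eqxx addn0 sh.
Qed.

(** Graham and Rothschild's theorem over the empty alphabet.  Once the colour
    of a word depends only on the position of its last new letter, it is
    enough to introduce new letters only at positions of one colour. *)
Lemma dual_ramsey_for_words k : dual_ramsey_words k.
Proof.
elim: k => [|k IH] m K.
  exists m => chi; exists (iota 0 m), (chi (word_comp (iota 0 m) [::])).
  split; [exact: size_iota | exact: rigid_word_iota |].
  by move=> g _ /rigid_word0->.
case: m => [|m].
  exists 0 => chi; exists [::], (chi [::]).
  by split=> //; apply: (rigid_word_iota 0).
have [n Hn] := color_depends_on_last_new_letter (#|K| * m).+2 K IH.
exists n => chi; have [f [c [sf rf Pf]]] := Hn chi.
have [|i le] := @popular_color K _ c (iota 1 (#|K| * m).+1) m.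
  by rewrite size_iota.
have [h [sh rh Ph]] := rigid_word_new_letters le.
exists (word_comp f h), (if k == 0 then c 0 else i); split.
- by rewrite size_word_comp.
- exact: rigid_word_comp rf sh rh.
move=> g sg rg; have [lf _ _] := rf; have [lh mh ih] := rh; have [lg mg ig] := rg.
rewrite (word_compA lf sh lh sg) Pf ?size_word_comp //; last exact: rigid_word_comp rh sg rg.
rewrite (index_word_comp rh) ?mg //.
have index0 w p : rigid_word p.+1 w -> index 0 w = 0.
  move=> rw; have [lw mw iw] := rw; case: w lw mw iw rw => [_ /(_ 0 isT)//|[//|b] w].
  rewrite /letters_below /= => /andP[bp _] _ /(_ 0 b.+1 isT bp).
  by rewrite /= eqxx.
have [->|k0] := posnP k; first by rewrite (index0 _ _ rg) (index0 _ _ rh).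
apply/eqP/Ph; last by rewrite -sg index_mem mg.
by apply: leq_ltn_trans (leq0n (index 0 g)) (ig 0 k k0 (ltnSn k)).
Qed.

(** * Finite chains as lists *)

Section Chains.
Variables (T : finType) (le : rel T).
Hypothesis linT : linear_order le.

Definition chain : seq T := sort le (enum T).

Lemma mem_chain x : x \in chain.
Proof. by rewrite mem_sort mem_enum. Qed.

Lemma size_chain : size chain = #|T|.
Proof. by rewrite size_sort cardE. Qed.

Lemma chain_uniq : uniq chain.
Proof. by rewrite sort_uniq enum_uniq. Qed.

Lemma index_chain_lt x : index x chain < #|T|.
Proof. by rewrite -size_chain index_mem mem_chain. Qed.

Lemma index_chain_inj : injective (fun x => index x chain).
Proof. by move=> x y; apply: (index_inj x); apply: mem_chain. Qed.

Lemma linear_order_refl x : le x x.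
Proof. by have [_ _ tot] := linT; have := tot x x; rewrite orbb. Qed.

Lemma le_chain x y : le x y = (index x chain <= index y chain).
Proof.
have [anti tr tot] := linT.
have ind z t : index z chain <= index t chain -> le z t.
  move=> zt; rewrite -(nth_index x (mem_chain z)) -(nth_index x (mem_chain t)).
  by apply: (sorted_leq_nth tr linear_order_refl x (sort_sorted tot _)) => //;
    rewrite inE index_mem mem_chain.
apply/idP/idP=> [xy|]; last exact: ind.
case: leqP => // lt.
have := anti x y; rewrite xy (ind _ _ (ltnW lt)) => /(_ isT) xyE.
by rewrite xyE ltnn in lt.
Qed.

Lemma strict_chain x y : strict le x y = (index x chain < index y chain).
Proof.
rewrite /strict le_chain ltn_neqAle; congr (~~ _ && _).
exact/esym/(inj_eq index_chain_inj).
Qed.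

Lemma index_map_chain (U : eqType) (f : T -> U) (u : U) (x : T) :
  is_min le (fun z => f z = u) x -> index u (map f chain) = index x chain.
Proof.
move=> [fx minx]; apply: (@index_unique _ u); rewrite ?size_map ?index_mem ?mem_chain //.
  by rewrite (nth_map x) ?index_mem ?mem_chain // nth_index ?mem_chain.
move=> j jx; have js : j < size chain by apply: leq_trans jx (index_size _ _).
rewrite (nth_map x) // => /minx; rewrite le_chain index_uniq ?chain_uniq //.
by rewrite leqNgt jx.
Qed.

End Chains.

Definition index_le (T : eqType) (s : seq T) : rel T :=
  fun x y => index x s <= index y s.

Lemma index_le_linear (T : eqType) (s : seq T) :
  (forall x, x \in s) -> linear_order (index_le s).
Proof.
move=> ms; split.
- by move=> x y /andP[xy yx]; apply: (index_inj x (ms x) (ms y)); apply/eqP; rewrite eqn_leq; apply/andP.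
- by move=> y x z; apply: leq_trans.
- by move=> x y; apply: leq_total.
Qed.

Lemma strict_index_le (T : eqType) (s : seq T) x y :
  index x s < index y s -> strict (index_le s) x y.
Proof.
move=> lt; rewrite /strict /index_le ltnW // andbT.
by apply: contraTneq lt => ->; rewrite ltnn.
Qed.

Definition map_word (S T : finType) (leS : rel S) (leT : rel T) (f : S -> T) :
    seq nat :=
  [seq index (f x) (chain leT) | x <- chain leS].

Lemma map_word_rigid (S T : finType) (leS : rel S) (leT : rel T) (f : S -> T) :
  linear_order leS -> linear_order leT -> rigid_surjection leS leT f ->
  rigid_word #|T| (map_word leS leT f).
Proof.
move=> linS linT [sf rf].
have idx y x : is_min leS (fun z => f z = y) x ->
    index (index y (chain leT)) (map_word leS leT f) = index x (chain leS).
  move=> minx; rewrite -(index_map_chain linS minx) /map_word.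
  rewrite (map_comp (fun t => index t (chain leT)) f).
  exact: (index_map (@index_chain_inj _ leT)).
have atT n : n < #|T| -> exists2 y, n = index y (chain leT) &
    exists x, is_min leS (fun z => f z = y) x.
  rewrite -(size_chain leT) => nT.
  have [y0 _] : exists y0 : T, True.
    by case: (chain leT) nT => // y s; exists y.
  exists (nth y0 (chain leT) n); first by rewrite index_uniq ?chain_uniq.
  have [x0 fx0] := sf (nth y0 (chain leT) n).
  by apply: is_min_exists fx0.
split.
- by apply/allP=> _ /mapP[x _ ->]; apply: index_chain_lt.
- move=> n /atT[y -> [x [fx _]]]; rewrite -fx.
  by apply/mapP; exists x; rewrite ?mem_chain.
- move=> n p np pT; have nT := ltn_trans np pT.
  have [y yE [x minx]] := atT n nT; have [z zE [t mint]] := atT p pT.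
  rewrite yE zE (idx _ _ minx) (idx _ _ mint) -strict_chain //.
  by apply: rf minx mint _; rewrite strict_chain // -yE -zE.
Qed.

(** Listing the values of [f] along the chain, a fibre precedes another one
    exactly when its minimum does. *)
Lemma induced_order (S T : finType) (leS : rel S) (f : S -> T) :
  linear_order leS -> surjective f ->
  linear_order (index_le (map f (chain leS))) /\
  rigid_surjection leS (index_le (map f (chain leS))) f.
Proof.
move=> linS sf; split.
  apply: index_le_linear => y; have [x <-] := sf y.
  by rewrite map_f // mem_chain.
split=> // b1 b2 a1 a2 min1 min2 /andP[ne].
rewrite /index_le (index_map_chain linS min1) (index_map_chain linS min2).
rewrite strict_chain // leq_eqVlt => /predU1P[/index_chain_inj aE|//].
by case/eqP: ne; rewrite -min1.1 -min2.1 aE.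
Qed.

(** * Relatively free groups *)

Section Morphisms.
Variables (G H : groupType) (f : G -> H).
Hypothesis fM : {morph f : x y / (x * y)%g}.

Lemma morph_one : f 1%g = 1%g.
Proof. by apply: (@mulgI _ (f 1%g)); rewrite -fM !mulg1. Qed.

Lemma morph_inv x : f x^-1%g = (f x)^-1%g.
Proof. by apply: (@mulgI _ (f x)); rewrite -fM !mulgV morph_one. Qed.

Lemma eval_term_morph (v : nat -> G) s :
  f (eval_term v s) = eval_term (f \o v) s.
Proof.
elim: s => [//||s IH|s IHs t IHt] /=; first exact: morph_one.
  by rewrite morph_inv IH.
by rewrite fM IHs IHt.
Qed.
End Morphisms.

(** An identity can be tested after the morphisms [p i], which commute with the
    evaluation of terms. *)
Lemma variety_of_separating_morphisms (V : groupType -> Prop) (G H : groupType)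
    (I : Type) (p : I -> G -> H) :
  is_variety V -> V H -> (forall i, {morph p i : x y / (x * y)%g}) ->
  (forall x y, (forall i, p i x = p i y) -> x = y) -> V G.
Proof.
move=> [E VE] /VE VH pM sep; apply/VE=> s t Est v; apply: sep => i.
by rewrite !(eval_term_morph (pM i)); apply: VH.
Qed.

Section RelativelyFree.
Variables (B : finGroupType) (n : nat).

Definition power_group : finGroupType := {dffun {ffun 'I_n -> B} -> B}.

Definition coordinate (t : 'I_n) : power_group :=
  [ffun u : {ffun 'I_n -> B} => u t].

Definition free_subgroup : {group power_group} :=
  <<[set coordinate t | t : 'I_n]>>%G.

(** The free group on [n] generators in the variety generated by [B]: every
    assignment of elements of [B] to the coordinates extends to it, as a
    projection of the power. *)
Definition free_group : finGroupType := subg_of free_subgroup.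

Lemma coordinate_in t : coordinate t \in free_subgroup.
Proof. by apply: mem_gen; apply: imset_f. Qed.

Definition free_gen (t : 'I_n) : free_group := Subg (coordinate_in t).

Definition free_ext (u : {ffun 'I_n -> B}) (x : free_group) : B := sgval x u.

Lemma free_extM u : {morph free_ext u : x y / (x * y)%g}.
Proof. by move=> x y; rewrite /free_ext /= ffunE. Qed.

Lemma free_ext_gen u t : free_ext u (free_gen t) = u t.
Proof. by rewrite /free_ext /= ffunE. Qed.

Lemma free_group_variety (V : groupType -> Prop) :
  is_variety V -> V B -> V free_group.
Proof.
move=> varV VB.
apply: (variety_of_separating_morphisms varV VB free_extM) => x y xy.
by apply: val_inj; apply/ffunP=> u; apply: xy.
Qed.

(** The elements at which [f] and [g] agree form a subgroup. *)
Lemma free_group_hom_eq (A : finGroupType) (f g : free_group -> A) :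
  {morph f : x y / (x * y)%g} -> {morph g : x y / (x * y)%g} ->
  (forall t, f (free_gen t) = g (free_gen t)) -> f =1 g.
Proof.
move=> fM gM fg.
pose E := [set z in free_subgroup |
  f (subg free_subgroup z) == g (subg free_subgroup z)].
have gE : group_set E.
  apply/group_setP; split.
    rewrite inE group1 /= (_ : subg _ _ = 1%g) ?(morph_one fM) ?(morph_one gM) //.
    by apply: val_inj; rewrite /= subgK // group1.
  move=> x y; rewrite !inE => /andP[xS /eqP xE] /andP[yS /eqP yE].
  by rewrite groupM //= subgM // fM gM xE yE.
have sub : free_subgroup \subset Group gE.
  rewrite gen_subG; apply/subsetP=> _ /imsetP[t _ ->].
  rewrite inE coordinate_in /= (_ : subg _ _ = free_gen t) ?fg //.
  by apply: val_inj; rewrite /= subgK // coordinate_in.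
move=> x; have := subsetP sub (sgval x) (subgP x).
by rewrite inE sgvalK => /andP[_ /eqP].
Qed.

(** The generators come first, in their given order, so that the least
    element of a fibre of an extension is the first generator in it. *)
Definition free_order : rel free_group :=
  index_le ([seq free_gen t | t <- enum 'I_n] ++ enum free_group).

Lemma free_order_linear : linear_order free_order.
Proof. by apply: index_le_linear => x; rewrite mem_cat mem_enum orbT. Qed.

Lemma nth_free_order x (t : 'I_n) :
  nth x ([seq free_gen t | t <- enum 'I_n] ++ enum free_group) t = free_gen t.
Proof.
rewrite nth_cat size_map size_enum_ord ltn_ord (nth_map t) ?size_enum_ord //.
by rewrite nth_ord_enum.
Qed.

Lemma free_ext_rigid (leB : rel B) (f : seq nat) (u : {ffun 'I_n -> B}) :
  linear_order leB -> size f = n -> rigid_word #|B| f ->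
  (forall t, index (u t) (chain leB) = nth 0 f t) ->
  rigid_surjection free_order leB (free_ext u).
Proof.
move=> linB sf rf uf; have [lf mf incf] := rf.
have first_gen b : exists t : 'I_n,
    t = index (index b (chain leB)) f :> nat /\ u t = b.
  have tn : index (index b (chain leB)) f < n.
    by rewrite -sf index_mem mf // index_chain_lt.
  exists (Ordinal tn); split=> //; apply: (@index_chain_inj _ leB).
  by rewrite uf nth_index // mf // index_chain_lt.
split=> [b|b1 b2 a1 a2 min1 min2].
  by have [t [_ <-]] := first_gen b; exists (free_gen t); rewrite free_ext_gen.
have idx b a : is_min free_order (fun x => free_ext u x = b) a ->
    index a ([seq free_gen t | t <- enum 'I_n] ++ enum free_group) =
    index (index b (chain leB)) f.
  move=> [ua mina]; have [t [tE ut]] := first_gen b.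
  set s := _ ++ _; have memS x : x \in s by rewrite mem_cat mem_enum orbT.
  have gens i : index (free_gen i) s <= i.
    rewrite leqNgt; apply/negP=> lt; have := before_find a lt.
    by rewrite nth_free_order /= eqxx.
  apply/eqP; rewrite eqn_leq -{1}tE; apply/andP; split.
    by apply: leq_trans (gens t); apply: mina; rewrite free_ext_gen.
  rewrite leqNgt; apply/negP=> lt.
  have jn : index a s < n by rewrite (ltn_trans lt) // -tE.
  have aE : a = free_gen (Ordinal jn).
    by rewrite -(nth_free_order a) nth_index.
  have := before_find 0 lt; rewrite /= -(uf (Ordinal jn)).
  have -> : u (Ordinal jn) = b by rewrite -ua [in RHS]aE free_ext_gen.
  by rewrite eqxx.
rewrite strict_chain // => lt; apply: strict_index_le.
by rewrite (idx _ _ min1) (idx _ _ min2); apply: incf lt _; apply: index_chain_lt.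
Qed.

End RelativelyFree.

(** * The Ramsey property of ordered groups *)

(** A colouring of morphisms to [A] is read as a colouring of words, and the
    word supplied by the theorem for words is turned back into a morphism from
    the free group onto [B]. *)
Lemma ordered_groups_dual_ramsey (V : groupType -> Prop) :
  is_variety V -> dual_ramsey_property (ord_fin_rigid_epi_category V).
Proof.
move=> varV k A B k2.
have [n Hn] := dual_ramsey_for_words #|og_group A| #|og_group B| 'I_k.
pose C : ord_fin_group V := OrdFinGroupIn
  (free_group_variety n varV (og_variety B)) (@free_order_linear B n).
exists C => chi.
have linA := og_linear A; have linB := og_linear B.
pose chA := chain (@og_le _ A); pose chB := chain (@og_le _ B).
(* A morphism to A is determined by the word of its values at the generators. *)
pose codes (v : seq nat) (phi : rigid_epi_hom C A) :=
  forall t : 'I_n, index (sval phi (free_gen B t)) chA = nth 0 v t.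
pose chi' (v : seq nat) : 'I_k :=
  match pselect (exists phi, codes v phi) with
  | left ex => chi (sval (cid ex))
  | right _ => Ordinal (ltnW k2)
  end.
have hom_ext (psi phi : rigid_epi_hom C A) : sval psi = sval phi -> psi = phi.
  by case: psi phi => [psi ?] [phi ?]; apply: eq_exist.
have chi'E v phi : codes v phi -> chi' v = chi phi.
  move=> cphi; rewrite /chi'; case: pselect => [ex|[]]; last by exists phi.
  case: (cid ex) => psi cpsi /=; congr chi; apply: hom_ext.
  apply/funext; apply: free_group_hom_eq.
  - exact: (svalP psi).1.1.
  - exact: (svalP phi).1.1.
  - by move=> t; apply: (@index_chain_inj _ (@og_le _ A)); rewrite cphi cpsi.
have [f [c [sf rf Pf]]] := Hn chi'.
pose u : {ffun 'I_n -> B} := [ffun t : 'I_n => nth 1%g chB (nth 0 f t)].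
have uf t : index (u t) chB = nth 0 f t.
  by rewrite ffunE index_uniq ?chain_uniq // size_chain rigid_word_nth ?sf.
have rsu := free_ext_rigid linB sf rf uf.
have epiu : @rigid_epimorphism V C B (free_ext u).
  by split=> //; split; [exact: free_extM | exact: rsu.1].
exists (exist _ (free_ext u) epiu).
rewrite -(cards1 c); apply/subset_leq_card/subsetP=> d; rewrite !inE => /asboolP[h <-].
apply/eqP; pose g := map_word (@og_le _ B) (@og_le _ A) (sval h).
have sg : size g = #|og_group B| by rewrite size_map size_chain.
rewrite -(Pf g sg (map_word_rigid linB linA (svalP h).2)).
apply/esym/chi'E => t /=.
have tf : t < size f by rewrite sf.
rewrite free_ext_gen /word_comp (nth_map 0) // /g /map_word (nth_map 1%g); last first.
  by rewrite size_chain rigid_word_nth.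
by rewrite ffunE.
Qed.

(** * Finite dual Ramsey degrees without orders *)

(** The colourings are dealt with one after the other: composing with a
    further morphism does not spoil those already made constant. *)
Lemma joint_dual_ramsey (K : category) (I : eqType) (A : I -> K) (k : nat)
    (B : K) (s : seq I) :
  dual_ramsey_property K -> 2 <= k ->
  exists C : K, forall chi : (forall i, hom C (A i) -> 'I_k),
    exists w : hom C B, forall i, i \in s ->
      exists c, forall f : hom B (A i), chi i (Defs.comp f w) = c.
Proof.
move=> RK k2; elim: s => [|i s [C HC]].
  by exists B => chi; exists (Defs.idm B).
have [D HD] := RK k (A i) C k2; exists D => chi.
have [w Hw] := HD (chi i).
have [v Hv] := HC (fun j f => chi j (Defs.comp f w)).
exists (Defs.comp v w) => j; rewrite inE => /predU1P[->|js]; last first.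
  by have [c Hc] := Hv j js; exists c => f; rewrite comp_assoc.
have [[f0 _]|nof] := pselect (exists f : hom B (A i), True); last first.
  by exists (Ordinal (ltnW k2)) => f; case: nof; exists f.
exists (chi i (Defs.comp f0 (Defs.comp v w))) => f.
apply: (card_le1_eqP Hw); rewrite inE; apply/asboolP.
  by exists (Defs.comp f0 v); rewrite comp_assoc.
by exists (Defs.comp f v); rewrite comp_assoc.
Qed.

(** The bound is the number of linear orders on [A].  Once [B] is ordered,
    each epimorphism from [B] to [A] is rigid for an order on [A], and the
    Ramsey property, applied to all orders on [A] in turn, leaves one colour
    for each of them. *)
Lemma groups_finite_dual_degrees (V : groupType -> Prop) :
  dual_ramsey_property (ord_fin_rigid_epi_category V) ->
  finite_dual_small_ramsey_degrees (fin_epi_category V).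
Proof.
move=> RV A.
suff [n Hn] : exists n, dual_degree_bound (K := fin_epi_category V) A n.
  by rewrite /dual_small_ramsey_degree; case: pselect => // -[]; exists n.
pose rel_of (o : {ffun A * A -> bool}) : rel A := fun x y => o (x, y).
pose I : finType := {o : {ffun A * A -> bool} | `[< linear_order (rel_of o) >]}.
have ofrel (le : rel A) : linear_order le -> exists i : I, rel_of (val i) = le.
  move=> linle; pose o := [ffun p : A * A => le p.1 p.2].
  have oE : rel_of o = le by apply/funext=> x; apply/funext=> y; rewrite /rel_of ffunE.
  have oP : `[< linear_order (rel_of o) >] by apply/asboolP; rewrite oE.
  by exists (exist _ o oP).
have linI (i : I) : linear_order (rel_of (val i)) by apply/asboolP/(valP i).
pose Ao (i : I) : ord_fin_group V := OrdFinGroupIn (fg_variety A) (linI i).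
exists #|I|; split.
  have [i _] := ofrel _ (@index_le_linear A (enum A) (mem_enum A)).
  by apply/card_gt0P; exists i.
move=> k B k2.
pose Bo : ord_fin_group V := OrdFinGroupIn (fg_variety B)
  (@index_le_linear B (enum B) (mem_enum B)).
have [C HC] := @joint_dual_ramsey (ord_fin_rigid_epi_category V) I Ao k Bo
  (enum I) RV k2.
exists (FinGroupIn (og_variety C)) => chi.
pose chiI i (phi : rigid_epi_hom C (Ao i)) : 'I_k :=
  chi (exist _ (sval phi) (svalP phi).1).
have [w Hw] := HC chiI.
exists (exist _ (sval w) (svalP w).1).
have [c Hc] : {c : I -> 'I_k & forall i (f : rigid_epi_hom Bo (Ao i)),
    chiI i (rigid_epi_comp f w) = c i}.
  apply: (@choice _ _ (fun i c => forall f, chiI i (rigid_epi_comp f w) = c)) => i.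
  by apply: Hw; rewrite mem_enum.
apply: leq_trans (leq_imset_card c I); apply/subset_leq_card/subsetP=> d.
rewrite inE => /asboolP[f <-].
have [lin rig] := induced_order (og_linear Bo) (svalP f).2.
have [i iE] := ofrel _ lin.
have rf : rigid_epimorphism (G := Bo) (H := Ao i) (sval f).
  by split; [exact: svalP f | rewrite /= iE].
apply/imsetP; exists i => //; rewrite -(Hc i (exist _ (sval f) rf)).
by congr chi; apply: eq_exist.
Qed.

Theorem corollary4p15 (V : groupType -> Prop) (HV : nontrivial_variety V) :
  dual_ramsey_property (ord_fin_rigid_epi_category V) /\
  finite_dual_small_ramsey_degrees (fin_epi_category V).
Proof.
have RV := ordered_groups_dual_ramsey HV.1.
by split=> //; apply: groups_finite_dual_degrees.
Qed.
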